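(* Let $H$ be a Hilbert space, let $Q\in\mathbb{B}(H)$ be an arbitrary non-projection idempotent, and let $\alpha\in\big[\|m(Q)-Q\|,\ \|I-m(Q)-Q\|\big]$ be arbitrary. Then there exists a projection $P\in\mathbb{B}(H)$ such that $\|P-Q\|=\alpha$.
   Context: $H$ is a non-zero complex Hilbert space and $\mathbb{B}(H)$ is the algebra of bounded linear operators on $H$ with the operator norm; $I$ is the identity. An idempotent is $Q\in\mathbb{B}(H)$ with $Q^2=Q$; a projection is a self-adjoint idempotent; a non-projection idempotent is an idempotent that is not self-adjoint. For $T\in\mathbb{B}(H)$, $|T|=(T^*T)^{1/2}$, and $T^\dag$ denotes the Moore-Penrose inverse of $T$ (when $T$ has closed range): the unique $X$ with $TXT=T$, $XTX=X$, $(TX)^*=TX$, $(XT)^*=XT$. The matched projection of an idempotent $Q$ is the projection $$m(Q)=\frac12\big(|Q^*|+Q^*\big)|Q^*|^\dag\big(|Q^*|+I\big)^{-1}\big(|Q^*|+Q\big).$$ *)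

(* Defs.v *)
From HB Require Import structures.
From mathcomp Require Import all_boot all_order all_algebra sesquilinear complex.
From mathcomp Require Import all_classical all_reals all_analysis.

Set Implicit Arguments.
Unset Strict Implicit.
Unset Printing Implicit Defensive.

Import Order.TTheory GRing.Theory Num.Theory.
Import numFieldNormedType.Exports.

Local Open Scope classical_set_scope.
Local Open Scope complex_scope.
Local Open Scope ring_scope.

(* The norm of a normed module over R[i] takes its values in R[i] (they are
   nonnegative reals), and so does the inner product, which is linear in its
   first argument and conjugate-linear in the second one. *)
HB.mixin Record CompleteNormedModule_isHilbert (R : realType) H
    & CompleteNormedModule R[i] H := {
  inner : {dot H for @Num.conj R[i]} ;
  innerE : forall x : H, inner x x = `|x| ^+ 2 }.

#[short(type="hilbertType")]
HB.structure Definition Hilbert (R : realType) :=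
  {H of CompleteNormedModule_isHilbert R H & CompleteNormedModule R[i] H}.

Record bop (R : realType) (H : hilbertType R) := Bop {
  bop_fun :> H -> H ;
  bop_linear : linear bop_fun ;
  bop_bounded : exists M : R[i], forall x : H, `|bop_fun x| <= M * `|x| }.

HB.instance Definition _ (R : realType) (H : hilbertType R) (T : bop H) :=
  GRing.isLinear.Build R[i] H H *:%R (bop_fun T) (@bop_linear R H T).

Section Algebra.
Variables (R : realType) (H : hilbertType R).
Implicit Types (S T U : bop H) (x y : H) (a : R[i]).

Lemma bopP S T : (forall x, S x = T x) -> S = T.
Proof.
case: S T => [S S1 S2] [T T1 T2] /= /funext ST.
by case: _ / ST in T1 T2 *; congr Bop; exact: Prop_irrelevance.
Qed.

Lemma bop_bound_ge0 T :
  exists2 M : R[i], 0 <= M & forall x, `|T x| <= M * `|x|.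
Proof.
have [M TM] := bop_bounded T.
have [[x x0]|H0] := pselect (exists x : H, x != 0); last first.
  exists 0 => // x; have -> : x = 0.
    by apply: contrapT => /eqP x0; apply: H0; exists x.
  by rewrite linear0 !normr0 mulr0.
exists M => //; have := le_trans (normr_ge0 _) (TM x).
by rewrite pmulr_lge0// normr_gt0.
Qed.

Fact bop0_linear : linear (fun _ : H => 0 : H).
Proof. by move=> a x y; rewrite scaler0 addr0. Qed.

Fact bop0_bounded : exists M : R[i], forall x, `|0 : H| <= M * `|x|.
Proof. by exists 0 => x; rewrite normr0 mul0r. Qed.

Definition bop0 : bop H := Bop bop0_linear bop0_bounded.

Fact bop1_linear : linear (fun x : H => x).
Proof. by []. Qed.

Fact bop1_bounded : exists M : R[i], forall x : H, `|x| <= M * `|x|.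
Proof. by exists 1 => x; rewrite mul1r. Qed.

Definition bop1 : bop H := Bop bop1_linear bop1_bounded.

Fact bop_add_linear S T : linear (fun x => S x + T x).
Proof. by move=> a x y; rewrite !linearP scalerDr addrACA. Qed.

Fact bop_add_bounded S T : exists M : R[i], forall x, `|S x + T x| <= M * `|x|.
Proof.
have [[M SM] [N TN]] := (bop_bounded S, bop_bounded T).
exists (M + N) => x; rewrite mulrDl.
by rewrite (le_trans (ler_normD _ _))// lerD.
Qed.

Definition bop_add S T : bop H := Bop (bop_add_linear S T) (bop_add_bounded S T).

Fact bop_scale_linear a T : linear (fun x => a *: T x).
Proof. by move=> b x y; rewrite linearP scalerDr !scalerA mulrC. Qed.

Fact bop_scale_bounded a T : exists M : R[i], forall x, `|a *: T x| <= M * `|x|.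
Proof.
have [M TM] := bop_bounded T; exists (`|a| * M) => x.
by rewrite normrZ -mulrA ler_wpM2l.
Qed.

Definition bop_scale a T : bop H :=
  Bop (bop_scale_linear a T) (bop_scale_bounded a T).

Fact bop_mul_linear S T : linear (fun x => S (T x)).
Proof. by move=> a x y; rewrite !linearP. Qed.

Fact bop_mul_bounded S T : exists M : R[i], forall x, `|S (T x)| <= M * `|x|.
Proof.
have [[M M0 SM] [N TN]] := (bop_bound_ge0 S, bop_bounded T).
by exists (M * N) => x; rewrite -mulrA (le_trans (SM _))// ler_wpM2l.
Qed.

Definition bop_mul S T : bop H := Bop (bop_mul_linear S T) (bop_mul_bounded S T).

HB.instance Definition _ := gen_eqMixin (bop H).
HB.instance Definition _ := gen_choiceMixin (bop H).

Fact bop_addA : associative bop_add.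
Proof. by move=> S T U; apply: bopP => x /=; rewrite addrA. Qed.

Fact bop_addC : commutative bop_add.
Proof. by move=> S T; apply: bopP => x /=; rewrite addrC. Qed.

Fact bop_add0 : left_id bop0 bop_add.
Proof. by move=> T; apply: bopP => x /=; rewrite add0r. Qed.

Fact bop_addN : left_inverse bop0 (bop_scale (-1)) bop_add.
Proof. by move=> T; apply: bopP => x /=; rewrite scaleN1r addNr. Qed.

HB.instance Definition _ :=
  GRing.isZmodule.Build (bop H) bop_addA bop_addC bop_add0 bop_addN.

Fact bop_mulA : associative bop_mul.
Proof. by move=> S T U; apply: bopP. Qed.

Fact bop_mul1l : left_id bop1 bop_mul.
Proof. by move=> T; apply: bopP. Qed.

Fact bop_mul1r : right_id bop1 bop_mul.
Proof. by move=> T; apply: bopP. Qed.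

Fact bop_mulDl : left_distributive bop_mul bop_add.
Proof. by move=> S T U; apply: bopP. Qed.

Fact bop_mulDr : right_distributive bop_mul bop_add.
Proof. by move=> S T U; apply: bopP => x /=; rewrite linearD. Qed.

(* Multiplication is composition. The ring is the zero ring when H is zero. *)
HB.instance Definition _ := GRing.Zmodule_isPzRing.Build (bop H)
  bop_mulA bop_mul1l bop_mul1r bop_mulDl bop_mulDr.

Fact bop_scaleA a b T : bop_scale a (bop_scale b T) = bop_scale (a * b) T.
Proof. by apply: bopP => x /=; rewrite scalerA. Qed.

Fact bop_scale1 : left_id 1 bop_scale.
Proof. by move=> T; apply: bopP => x /=; rewrite scale1r. Qed.

Fact bop_scaleDr : right_distributive bop_scale +%R.
Proof. by move=> a S T; apply: bopP => x /=; rewrite scalerDr. Qed.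

Fact bop_scaleDl T : {morph bop_scale^~ T : a b / a + b}.
Proof. by move=> a b; apply: bopP => x /=; rewrite scalerDl. Qed.

HB.instance Definition _ := GRing.Zmodule_isLmodule.Build R[i] (bop H)
  bop_scaleA bop_scale1 bop_scaleDr bop_scaleDl.

Lemma bop_addE S T x : (S + T) x = S x + T x.
Proof. by []. Qed.

Lemma bop_oppE T x : (- T) x = - T x.
Proof. exact: scaleN1r. Qed.

Lemma bop_scaleE a T x : (a *: T) x = a *: T x.
Proof. by []. Qed.

Lemma bop_mulE S T x : (S * T) x = S (T x).
Proof. by []. Qed.

Lemma bop_1E x : (1 : bop H) x = x.
Proof. by []. Qed.

End Algebra.

(* Each operator below that is specified by a property is unique when it
   exists; xget 0 A is the chosen element of A, and is 0 if A is empty. *)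
Section Operators.
Variables (R : realType) (H : hilbertType R).
Implicit Types (P Q S T X : bop H) (x y : H).

Definition opnorm T : R :=
  sup [set complex.Re `|T x| | x in [set x : H | `|x| <= 1]].

Definition adj T : bop H :=
  xget 0 [set S : bop H | forall x y, inner (T x) y = inner x (S y)].

(* In the order of R[i], 0 <= z means that z is real and nonnegative. *)
Definition is_positive T := forall x, 0 <= inner (T x) x.

Definition op_sqrt T : bop H :=
  xget 0 [set S : bop H | is_positive S /\ S * S = T].

Definition op_abs T : bop H := op_sqrt (adj T * T).

Definition op_inv T : bop H := xget 0 [set X : bop H | T * X = 1 /\ X * T = 1].

Definition is_MP_inverse T X :=
  [/\ T * X * T = T, X * T * X = X,
      adj (T * X) = T * X & adj (X * T) = X * T].

Definition MP_inv T : bop H := xget 0 [set X : bop H | is_MP_inverse T X].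

Definition is_self_adjoint T := adj T = T.

Definition is_idempotent Q := Q * Q = Q.

Definition is_projection P := is_idempotent P /\ is_self_adjoint P.

Definition matched_projection Q : bop H :=
  2^-1 *: ((op_abs (adj Q) + adj Q) * MP_inv (op_abs (adj Q))
           * op_inv (op_abs (adj Q) + 1) * (op_abs (adj Q) + Q)).

End Operators.

(* Main.v *)
(* No formula for the two norms is needed.  Write [M] for the matched
   projection.  If alpha is the upper bound, take [1 - M].  Otherwise some
   vector [x] satisfies |(1 - M - Q) x| > alpha |x|, and since [M] is neither
   [0] nor [1] it can be perturbed so that [M x] and [x - M x] are both nonzero.
   Replacing the line of [M x] inside the range of [M] by a line rotating
   towards [x - M x] gives a norm-continuous path of projections from [M] to a
   projection [P] with P x = x - M x, hence |P - Q| > alpha, and the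
   intermediate value theorem applies.

   That [M] is a projection rests on D = (Q + Q^* - 1)^2 = 1 + |Q - Q^*|^2: it
   is invertible, and agrees with QQ^* on the range of [Q], so that |Q^*| is
   obtained from the square root of [D], and its Moore-Penrose inverse is
   |Q^*| D^-1. *)
Require Import Defs.
From HB Require Import structures.
From mathcomp Require Import all_boot all_order all_algebra sesquilinear complex.
From mathcomp Require Import all_classical all_reals all_analysis.
From mathcomp Require Import ring lra.
Import Order.TTheory GRing.Theory Num.Theory.
Import numFieldNormedType.Exports.
Set Implicit Arguments.
Unset Strict Implicit.
Unset Printing Implicit Defensive.
Local Open Scope classical_set_scope.
Local Open Scope ring_scope.
Local Open Scope complex_scope.

(** * The underlying real inner product *)

Section RealHilbert.
Context {R : realType} {H : hilbertType R}.
Implicit Types (x y z : H) (k : R).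

(** The norm and the inner product live in [R[i]]. Their real parts lose nothing, by [normE] and
    [inner_eq], and make estimates accessible to ordered-field arithmetic over [R]. *)
Definition nr x : R := complex.Re `|x|.
Definition dot x y : R := complex.Re (inner x y).

Lemma ReD (a b : R[i]) : complex.Re (a + b) = complex.Re a + complex.Re b.
Proof. by case: a b => ? ? []. Qed.

Lemma ReN (a : R[i]) : complex.Re (- a) = - complex.Re a.
Proof. by case: a. Qed.

Lemma ReZ k (a : R[i]) : complex.Re (k%:C * a) = k * complex.Re a.
Proof. by case: a => a b /=; rewrite mul0r subr0. Qed.

Lemma Reconj (a : R[i]) : complex.Re a^* = complex.Re a.
Proof. by case: a. Qed.

Lemma Re_iM (a : R[i]) : complex.Re ('i * a) = - complex.Im a.
Proof. by case: a => a b /=; rewrite mul0r mul1r sub0r. Qed.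

Lemma normE x : `|x| = (nr x)%:C.
Proof. by rewrite /nr RRe_real// ger0_real. Qed.

Lemma nr_ge0 x : 0 <= nr x.
Proof. by rewrite -ler0c -normE. Qed.

Lemma nr_eq0 x : (nr x == 0) = (x == 0).
Proof. by rewrite -[RHS]normr_eq0 normE eq_complex /= eqxx andbT. Qed.

Lemma nr0 : nr (0 : H) = 0.
Proof. by apply/eqP; rewrite nr_eq0. Qed.

Lemma nr_gt0 x : (0 < nr x) = (x != 0).
Proof. by rewrite lt_def nr_ge0 andbT nr_eq0. Qed.

Lemma nrD x y : nr (x + y) <= nr x + nr y.
Proof. by rewrite -lecR rmorphD/= -!normE ler_normD. Qed.

Lemma nrN x : nr (- x) = nr x.
Proof. by rewrite /nr normrN. Qed.

Lemma nrBC x y : nr (x - y) = nr (y - x).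
Proof. by rewrite -nrN opprB. Qed.

Lemma nrZ k x : nr (k%:C *: x) = `|k| * nr x.
Proof. by rewrite /nr normrZ normE normc_def /= expr0n addr0 sqrtr_sqr; ring. Qed.

Lemma innerC x y : inner x y = (inner y x)^*.
Proof. by rewrite hermC/= expr0 mul1r. Qed.

Lemma dotC x y : dot x y = dot y x.
Proof. by rewrite /dot innerC Reconj. Qed.

Lemma dotDl x y z : dot (x + y) z = dot x z + dot y z.
Proof. by rewrite /dot linearDl ReD. Qed.

Lemma dotNl x y : dot (- x) y = - dot x y.
Proof. by rewrite /dot linearNl ReN. Qed.

Lemma dotZl k x y : dot (k%:C *: x) y = k * dot x y.
Proof. by rewrite /dot linearZl_LR ReZ. Qed.

Lemma dotDr x y z : dot x (y + z) = dot x y + dot x z.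
Proof. by rewrite dotC dotDl !(dotC x). Qed.

Lemma dotNr x y : dot x (- y) = - dot x y.
Proof. by rewrite dotC dotNl dotC. Qed.

Lemma dotZr k x y : dot x (k%:C *: y) = k * dot x y.
Proof. by rewrite dotC dotZl dotC. Qed.

Lemma dotxx x : dot x x = nr x ^+ 2.
Proof. by rewrite /dot innerE normE -rmorphXn. Qed.

Lemma nrD_sqr x y : nr (x + y) ^+ 2 = nr x ^+ 2 + 2 * dot x y + nr y ^+ 2.
Proof. rewrite -!dotxx dotDl !dotDr (dotC y x); ring. Qed.

Lemma dot_le x y : dot x y <= nr x * nr y.
Proof.
have [->|x0] := eqVneq x 0.
  by rewrite nr0 mul0r /dot linear0l.
have [->|y0] := eqVneq y 0.
  by rewrite nr0 mulr0 /dot linear0r.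
have p : 0 < nr x * nr y by rewrite mulr_gt0// nr_gt0.
(* Expanding this square gives Cauchy-Schwarz multiplied by 2 |x| |y|. *)
have := sqr_ge0 (nr ((nr y)%:C *: x - (nr x)%:C *: y)).
rewrite nrD_sqr nrN !nrZ dotNr dotZl dotZr !ger0_norm ?nr_ge0// => h.
rewrite -(ler_pM2l p); lra.
Qed.

Lemma dot_norm_le x y : `|dot x y| <= nr x * nr y.
Proof. by rewrite ler_norml dot_le andbT lerNl -dotNl -(nrN x) dot_le. Qed.

Lemma innerZi x y : complex.Im (inner x y) = - dot ('i *: x) y.
Proof. by rewrite /dot linearZl_LR Re_iM opprK. Qed.

Lemma dot_i x y : dot ('i *: x) y = - dot x ('i *: y).
Proof.
rewrite /dot linearZl_LR linearZr_LR/=; case: (inner x y) => a b /=; ring.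
Qed.

(** The imaginary part of an inner product is a real part taken at ['i *: x], by [innerZi]. *)
Lemma inner_eq (x y x' y' : H) : dot x y = dot x' y' ->
  dot ('i *: x) y = dot ('i *: x') y' -> inner x y = inner x' y'.
Proof.
by move=> h1 h2; apply/eqP; rewrite eq_complex !innerZi h2 -/(dot x y) h1 !eqxx.
Qed.

Lemma dot_inj y z : (forall x, dot x y = dot x z) -> y = z.
Proof.
move=> h; apply/eqP; rewrite -subr_eq0 -nr_eq0 -sqrf_eq0 -dotxx dotDr dotNr.
by rewrite !h subrr.
Qed.

End RealHilbert.

(** * Geometric convergence *)

Lemma geom_le0 {R : realType} (a C r : R) : 0 <= r < 1 ->
  (forall n, a <= C * r ^+ n) -> a <= 0.
Proof.
move=> /andP[r0 r1] h.
have c : (C *: r ^+ n : R^o) @[n --> \oo] --> (C *: 0 : R^o).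
  by apply: cvgZr; apply: cvg_expr; rewrite ger0_norm.
rewrite scaler0 in c.
rewrite -(cvg_lim _ c)//; apply: limr_ge; first by apply/cvg_ex; exists 0.
by apply: nearW => n; exact: h.
Qed.

(** Completeness of [H] with an explicit rate, so that later limit arguments reduce to
    [geom_le0]. *)
Lemma geom_cvg {R : realType} {H : hilbertType R} (u : nat -> H) (K r : R) :
  0 <= r < 1 -> (forall n, nr (u n.+1 - u n) <= K * r ^+ n) ->
  exists l, forall n, nr (l - u n) <= K / (1 - r) * r ^+ n.
Proof.
move=> /[dup] rb /andP[r0 r1] hu.
have K0 : 0 <= K by have := le_trans (nr_ge0 _) (hu 0%N); rewrite expr0 mulr1.
have r1' : 0 < 1 - r by rewrite subr_gt0.
set C := K / (1 - r).
have C0 : 0 <= C by rewrite divr_ge0// ltW.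
(* Keeping the term [C * r ^+ (n + m)] makes the induction telescope, since [K = C * (1 - r)]. *)
have aux n m : nr (u (n + m)%N - u n) <= C * r ^+ n - C * r ^+ (n + m).
  elim: m => [|m IH]; first by rewrite addn0 !subrr nr0.
  rewrite -(subrKA (u (n + m)%N)) (le_trans (nrD _ _))// addnS.
  apply: le_trans (lerD (hu _) IH) _.
  have -> : K = C * (1 - r) by rewrite /C mulfVK// gt_eqF.
  by rewrite exprS; lra.
have aux' n m : nr (u (n + m)%N - u n) <= C * r ^+ n.
  by apply: le_trans (aux n m) _; rewrite gerBl mulr_ge0// exprn_ge0.
have cu : cvg (u @ \oo).
  apply/cauchy_cvgP/cauchyP => e e0.
  have [N hN] : exists n, C * r ^+ n < complex.Re e.
    apply: contrapT => /forallNP h.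
    have : complex.Re e <= 0.
      by apply: (@geom_le0 R _ C r rb) => n; rewrite leNgt; apply/negP.
    by move: e0; rewrite ltcE => /andP[_ /lt_le_trans] h1 /h1; rewrite ltxx.
  exists (u N); exists N => // n /= Nn.
  rewrite -ball_normE /ball_ /= distrC normE -(RRe_real (gtr0_real e0)) ltcR.
  by apply: le_lt_trans hN; rewrite -(subnKC Nn).
move: cu => /cvg_ex[/= l cl]; exists l => n.
apply/ler_addgt0Pl => e e0.
move: cl => /cvgrPdist_lt /(_ e%:C); rewrite ltcR => /(_ e0)[N _ hN].
have := hN (n + N)%N; rewrite /= leq_addl normE ltcR => /(_ isT) h.
rewrite -(subrKA (u (n + N)%N)) (le_trans (nrD _ _))// lerD//.
exact: ltW.
Qed.

(** * Riesz representation and adjoints *)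

Section Riesz.
Context {R : realType} {H : hilbertType R}.
Variables (g : H -> R) (M : R).
Hypotheses (gD : forall x y, g (x + y) = g x + g y)
  (gZ : forall k x, g (k%:C *: x) = k * g x)
  (gM : forall x, g x <= M * nr x).

(* The Riesz vector minimises [x |-> |x|^2 - 2 g x]. *)
Let J x := nr x ^+ 2 - 2 * g x.

(** The parallelogram law: near-minimisers of [J] are close together, because [J] at their midpoint
    is at least the infimum. *)
Let J_midpoint x y : nr (x - y) ^+ 2 =
  2 * J x + 2 * J y - 4 * J ((2^-1)%:C *: (x + y)).
Proof.
rewrite /J nrZ gZ gD exprMn real_normK ?num_real// !nrD_sqr nrN dotNr.
by field.
Qed.

Let J_inf : has_inf (range J).
Proof.
split; first by exists (J 0), 0.
exists (- M ^+ 2) => _ [x _ <-]; rewrite /J.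
have := gM x; have := sqr_ge0 (nr x - M); lra.
Qed.

Lemma riesz_dot : exists z, forall x, g x = dot x z.
Proof.
set m := inf (range J).
have Jm x : m <= J x by apply: inf_lbound; [case: J_inf | exists x].
(* Values within 4^-n of the infimum put consecutive terms at distance of order 2^-n, the square
   root. *)
have /choice[u Ju] n : exists x, J x < m + 4^-1 ^+ n.
  have e0 : (0 : R) < 4^-1 ^+ n by rewrite exprn_gt0// invr_gt0.
  by have [_ [x _ <-] h] := inf_adherent e0 J_inf; exists x.
have p4 n : (4^-1 ^+ n : R) = (2^-1 ^+ n) ^+ 2.
  by rewrite exprAC; congr (_ ^+ _); field.
have half : 0 <= (2^-1 : R) < 1 by lra.
have pos n : (0 : R) < 2^-1 ^+ n by rewrite exprn_gt0// invr_gt0.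
have [n|l hl] := @geom_cvg R H u 2 2^-1 half.
  rewrite -(@ler_pXn2r _ 2)// ?nnegrE ?nr_ge0 ?mulr_ge0 ?ltW//.
  rewrite J_midpoint exprMn -p4.
  have := Ju n; have := Ju n.+1; have := Jm ((2^-1)%:C *: (u n.+1 + u n)).
  rewrite exprS; have := pos n; rewrite p4; set w := 2^-1 ^+ n => w0.
  have : 0 < w ^+ 2 by rewrite exprn_gt0.
  lra.
set C := _ / _ in hl.
(* The minimality inequality J(u n + h) >= J(u n) - 4^-n, passed to the limit [l]. *)
have key h : 0 <= 2 * (dot l h - g h) + nr h ^+ 2.
  rewrite -oppr_le0; apply: (@geom_le0 R _ (2 * C * nr h + 1) _ half) => n.
  have := Jm (u n + h); have := Ju n; rewrite p4 /J nrD_sqr gD.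
  have := dot_norm_le (l - u n) h; rewrite dotDl dotNl ler_norml => /andP[+ _].
  have := ler_wpM2r (nr_ge0 h) (hl n).
  have : (2^-1 ^+ n) ^+ 2 <= (2^-1 ^+ n : R).
    rewrite expr2 ler_piMl//.
    by apply: exprn_ile1; lra.
  move: (2^-1 ^+ n) (C) => w C'; lra.
exists l => h; rewrite dotC; apply/eqP; rewrite -subr_eq0.
apply/negP => /negP; set a := g h - _ => a0.
(* Testing [key] along [t * a] times [h] gives t a^2 (t |h|^2 - 2) >= 0, impossible since t |h|^2 <=
   1. *)
set t := (nr h ^+ 2 + 1)^-1.
have t0 : 0 < t by rewrite invr_gt0 ltr_wpDl// sqr_ge0.
have := key ((t * a)%:C *: h); rewrite dotZr gZ nrZ exprMn real_normK ?num_real//.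
have -> : 2 * (t * a * dot l h - t * a * g h) + (t * a) ^+ 2 * nr h ^+ 2 =
   t * a ^+ 2 * (t * nr h ^+ 2 - 2) by rewrite /a; ring.
rewrite pmulr_rge0; last by rewrite mulr_gt0// exprn_even_gt0.
have : t * (nr h ^+ 2 + 1) = 1 by rewrite mulVf// gt_eqF// ltr_wpDl// sqr_ge0.
have := sqr_ge0 (nr h); lra.
Qed.

End Riesz.

Section Adjoint.
Context {R : realType} {H : hilbertType R}.
Implicit Types (S T : bop H) (x y : H).

Lemma bop_nr_bound T : exists2 K, 0 <= K & forall x, nr (T x) <= K * nr x.
Proof.
have [M M0 TM] := bop_bound_ge0 T; exists (complex.Re M) => [|x].
  by move: M0; rewrite lecE => /andP[].
have := TM x; rewrite !normE -(RRe_real (ger0_real M0)) -rmorphM.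
by rewrite /= lecR.
Qed.

Lemma mkbop (f : H -> H) K : linear f -> (forall x, nr (f x) <= K * nr x) ->
  exists T : bop H, forall x, T x = f x.
Proof.
move=> lf fK.
have b : exists M : R[i], forall x, `|f x| <= M * `|x|.
  by exists K%:C => x; rewrite !normE -rmorphM /= lecR.
by exists (Bop lf b).
Qed.

Lemma inner_inj y z : (forall x : H, inner x y = inner x z) -> y = z.
Proof. by move=> h; apply: dot_inj => x; rewrite /dot h. Qed.

(** Riesz is applied to the real functional [dot (T x) y]; evaluating it also at ['i *: x] recovers
    the complex identity, from which linearity of the adjoint follows. *)
Lemma adj_exists T : exists S : bop H,
  forall x y, inner (T x) y = inner x (S y).
Proof.
have [K K0 TK] := bop_nr_bound T.
have /choice[f fE] y : exists z, forall x, inner (T x) y = inner x z.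
  have [x x'|k x|x|z hz] := @riesz_dot R H (fun x => dot (T x) y) (K * nr y).
  - by rewrite linearD dotDl.
  - by rewrite linearZ dotZl.
  - by rewrite (le_trans (dot_le _ _))// mulrAC ler_wpM2r ?nr_ge0.
  by exists z => x; apply: inner_eq; rewrite -?linearZ hz.
have lf : linear f.
  move=> a y y'; apply: inner_inj => x.
  by rewrite -fE !linearDr/= !linearZr_LR/= !fE.
have [|S SE] := @mkbop f K lf.
  move=> y; have [->|y0] := eqVneq (f y) 0.
    by rewrite nr0 mulr_ge0// nr_ge0.
  rewrite -(@ler_pM2r _ (nr (f y))) ?nr_gt0// -expr2 -dotxx {1}/dot -fE.
  rewrite -/(dot _ _) (le_trans (dot_le _ _))// mulrAC ler_wpM2r ?nr_ge0//.
by exists S => x y; rewrite SE fE.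
Qed.

Lemma adjP T x y : inner (T x) y = inner x (adj T y).
Proof.
rewrite /adj; case: xgetP => [S _ /(_ x y)//|].
by have [S SE] := adj_exists T => /(_ S)/(_ SE).
Qed.

Lemma adj_dot T x y : dot (T x) y = dot x (adj T y).
Proof. by rewrite /dot adjP. Qed.

Lemma adj_uniq T S : (forall x y, dot (T x) y = dot x (S y)) -> adj T = S.
Proof.
move=> TS; apply: bopP => y; apply: dot_inj => x.
by rewrite -TS adj_dot.
Qed.

Lemma adjK T : adj (adj T) = T.
Proof. by apply: adj_uniq => x y; rewrite dotC -adj_dot dotC. Qed.

Lemma adjM S T : adj (S * T) = adj T * adj S.
Proof. by apply: adj_uniq => x y; rewrite !bop_mulE !adj_dot. Qed.

Lemma adjD S T : adj (S + T) = adj S + adj T.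
Proof. by apply: adj_uniq => x y; rewrite !bop_addE dotDl dotDr !adj_dot. Qed.

Lemma adjN T : adj (- T) = - adj T.
Proof. by apply: adj_uniq => x y; rewrite !bop_oppE dotNl dotNr !adj_dot. Qed.

Lemma adj_bopZ (k : R) T : adj (k%:C *: T) = k%:C *: adj T.
Proof. by apply: adj_uniq => x y; rewrite !bop_scaleE dotZl dotZr !adj_dot. Qed.

Lemma adj_bop1 : adj (1 : bop H) = 1.
Proof. exact: adj_uniq. Qed.

Lemma adj_bop0 : adj (0 : bop H) = 0.
Proof. by apply: adj_uniq => x y; rewrite /= /dot linear0l linear0r. Qed.

Lemma nr_adj_eq0 T x : (adj T * T) x = 0 -> T x = 0.
Proof.
move=> h; apply/eqP; rewrite -nr_eq0 -sqrf_eq0 -dotxx adj_dot -bop_mulE h.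
by rewrite /dot linear0r.
Qed.

(** Here complex scalars matter: [inner (T x) x] being real means that [dot (T ('i *: x)) x]
    vanishes, and polarising this at [z + y] gives symmetry. *)
Lemma is_positive_sa T : is_positive T -> adj T = T.
Proof.
move=> T0.
have T_i x : dot (T ('i *: x)) x = 0.
  have := T0 x; rewrite lecE linearZ/= => /andP[/eqP + _].
  by rewrite -[dot _ _]opprK -innerZi => ->; rewrite oppr0.
apply: adj_uniq => x y.
have -> : x = 'i *: (- 'i *: x).
  by rewrite scalerA mulrN -expr2 sqr_i opprK scale1r.
move: (- 'i *: x) => z.
have := T_i (z + y); rewrite scalerDr linearD dotDl !dotDr !T_i add0r addr0.
move=> /eqP; rewrite addr_eq0 => /eqP ->.
by rewrite linearZ [in LHS]dot_i opprK dotC.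
Qed.

Lemma is_positive_dot T : adj T = T -> (forall x, 0 <= dot (T x) x) ->
  is_positive T.
Proof.
move=> sT T0 x; rewrite lecE /= -/(dot _ _) T0 andbT.
apply/eqP; have := innerC (T x) x; rewrite adjP sT.
by case: (inner _ _) => a b [] /=; lra.
Qed.

End Adjoint.

(** * Operator limits *)

Section BoundedOperators.
Context {R : realType} {H : hilbertType R}.
Implicit Types (A S T U X Y : bop H) (x y : H) (k e r : R).

Lemma bop_scaleAl (a : R[i]) S T : (a *: S) * T = a *: (S * T).
Proof. exact: bopP. Qed.

Lemma bop_scaleAr (a : R[i]) S T : S * (a *: T) = a *: (S * T).
Proof. by apply: bopP => x; rewrite !(bop_mulE, bop_scaleE) linearZ. Qed.

Lemma bop_subE S T x : (S - T) x = S x - T x.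
Proof. by rewrite bop_addE bop_oppE. Qed.

(** The bound on the operator norm by [k], stated pointwise so that estimates compose without a
    supremum. *)
Definition opb k T := forall x, nr (T x) <= k * nr x.

Lemma opb_exists T : exists2 k, 0 <= k & opb k T.
Proof. exact: bop_nr_bound. Qed.

Lemma opbW k k' T : k <= k' -> opb k T -> opb k' T.
Proof. by move=> kk' Tk x; rewrite (le_trans (Tk x))// ler_wpM2r// nr_ge0. Qed.

Lemma opb0 k : 0 <= k -> opb k 0.
Proof. by move=> k0 x; rewrite /= nr0 mulr_ge0// nr_ge0. Qed.

Lemma opbD k l S T : opb k S -> opb l T -> opb (k + l) (S + T).
Proof.
by move=> Sk Tl x; rewrite bop_addE (le_trans (nrD _ _))// mulrDl lerD.
Qed.

Lemma opbN k T : opb k T -> opb k (- T).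
Proof. by move=> Tk x; rewrite bop_oppE nrN. Qed.

Lemma opbBC k S T : opb k (S - T) -> opb k (T - S).
Proof. by rewrite -[T - S]opprB; exact: opbN. Qed.

Lemma opbZ k l T : opb k T -> opb (`|l| * k) (l%:C *: T).
Proof. by move=> Tk x; rewrite bop_scaleE nrZ -mulrA ler_wpM2l. Qed.

Lemma opbM k l S T : 0 <= k -> opb k S -> opb l T -> opb (k * l) (S * T).
Proof.
by move=> k0 Sk Tl x; rewrite bop_mulE (le_trans (Sk _))// -mulrA ler_wpM2l.
Qed.

Lemma opb_adj k T : 0 <= k -> opb k T -> opb k (adj T).
Proof.
move=> k0 Tk x; have [->|y0] := eqVneq (adj T x) 0.
  by rewrite nr0 mulr_ge0// nr_ge0.
rewrite -(@ler_pM2r _ (nr (adj T x))) ?nr_gt0// -expr2 -dotxx -adj_dot.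
by rewrite (le_trans (dot_le _ _))// mulrAC ler_wpM2r ?nr_ge0.
Qed.

Lemma opb_eq0 T : (forall e, 0 < e -> opb e T) -> T = 0.
Proof.
move=> h; apply: bopP => x; apply/eqP; rewrite -nr_eq0 eq_le nr_ge0 andbT.
rewrite leNgt; apply/negP => Tx; have [x0|x0] := eqVneq x 0.
  by move: Tx; rewrite x0 linear0 nr0 ltxx.
have p : 0 < nr (T x) / (2 * nr x) by rewrite divr_gt0// mulr_gt0// nr_gt0.
have := h _ p x; rewrite invfM mulrA mulfVK ?nr_eq0//.
move: Tx; lra.
Qed.

Lemma opb_geom_small (K r e : R) : 0 <= r < 1 -> 0 < e ->
  exists n, K * r ^+ n < e.
Proof.
move=> rb e0; apply: contrapT => /forallNP h.
suff : e <= 0 by rewrite leNgt e0.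
by apply: (@geom_le0 R _ K r rb) => n; rewrite leNgt; apply/negP.
Qed.

Lemma nrZc (a : R[i]) x : nr (a *: x) = complex.Re `|a| * nr x.
Proof.
by rewrite {1}/nr normrZ normE -(RRe_real (normr_real a)) ReZ.
Qed.

(** The limit is taken pointwise by [geom_cvg]; its rate is proportional to [nr x], so convergence
    holds in operator norm. *)
Lemma bop_geom_cvg (T : nat -> bop H) K r : 0 <= r < 1 ->
  (forall n, opb (K * r ^+ n) (T n.+1 - T n)) ->
  exists L, forall n, opb (K / (1 - r) * r ^+ n) (L - T n).
Proof.
move=> rb hT.
have /choice[f hf] x : exists l,
    forall n, nr (l - T n x) <= K / (1 - r) * r ^+ n * nr x.
  have [n|l hl] := @geom_cvg R H (T ^~ x) (K * nr x) r rb.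
    by rewrite mulrAC -bop_subE; exact: hT.
  by exists l => n; rewrite (le_trans (hl n))// -!mulrA (mulrCA (nr x))
    (mulrC (nr x)).
set C := K / (1 - r) in hf *.
have lf : linear f.
  move=> a x y; apply/eqP; rewrite -subr_eq0 -nr_eq0 eq_le nr_ge0 andbT.
  pose c := C * nr (a *: x + y) + complex.Re `|a| * (C * nr x) + C * nr y.
  apply: (@geom_le0 R _ c r rb) => n.
  (* The linearity defect of [f] is compared with that of [T n], which is zero; what remains is
     geometrically small. *)
  rewrite (_ : f _ - _ = f (a *: x + y) - T n (a *: x + y) +
      a *: (T n x - f x) + (T n y - f y)); last first.
    by rewrite (linearP (T n)) scalerBr -addrA (addrACA (a *: T n x))
      -opprD addrA subrK.
  have h1 := hf (a *: x + y) n.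
  have := hf x n; rewrite nrBC => h2; have := hf y n; rewrite nrBC => h3.
  apply: le_trans (nrD _ _) _; rewrite (le_trans (lerD (nrD _ _) h3))//.
  rewrite nrZc /c [leRHS]mulrDl mulrDl; apply: lerD; last by rewrite mulrAC.
  apply: lerD; first by rewrite mulrAC.
  rewrite -mulrA ler_wpM2l ?(le_trans h2)// 1?mulrAC//.
  by rewrite -ler0c RRe_real// normr_real.
have [k k0 hk] := opb_exists (T 0%N).
have [x|L LE] := @mkbop R H f (C + k) lf.
  rewrite -(subrK (T 0%N x) (f x)) (le_trans (nrD _ _))// mulrDl lerD//.
  by have := hf x 0%N; rewrite mulr1.
by exists L => n x; rewrite bop_subE LE.
Qed.

(** Banach's fixed point theorem inside a norm-closed class [P], iterating from 0. The class carries
    the properties wanted of the limit and may confine [F] to a ball where it contracts. *)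
Lemma bop_fixpoint (F : bop H -> bop H) (P : bop H -> Prop) r : 0 <= r < 1 ->
  P 0 -> (forall T, P T -> P (F T)) ->
  (forall L, (forall e, 0 < e -> exists2 T, P T & opb e (L - T)) -> P L) ->
  (forall S T k, P S -> P T -> 0 <= k -> opb k (S - T) ->
    opb (r * k) (F S - F T)) ->
  exists2 L, P L & F L = L.
Proof.
move=> /[dup] rb /andP[r0 r1] P0 PF Pcl FC.
pose T n := iter n F 0.
have PT n : P (T n) by elim: n => // n; exact: PF.
have [K K0 FK] := opb_exists (F 0).
have [n|L hL] := @bop_geom_cvg T K r rb.
  elim: n => [|n IH]; first by rewrite expr0 mulr1 subr0.
  rewrite exprS mulrCA; apply: (FC (T n.+1) (T n)) => //; try exact: PT.
  by rewrite mulr_ge0// exprn_ge0.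
have C0 : 0 <= K / (1 - r) by rewrite divr_ge0// subr_ge0 ltW.
have PL : P L.
  apply: Pcl => e e0; have [n hn] := @opb_geom_small (K / (1 - r)) r e rb e0.
  by exists (T n) => //; apply: opbW (hL n); exact: ltW.
exists L => //; apply/eqP; rewrite -subr_eq0; apply/eqP/opb_eq0 => e e0.
have [n hn] := @opb_geom_small (2 * (K / (1 - r))) r e rb e0.
rewrite -(subrKA (T n.+1)).
have w0 : 0 <= K / (1 - r) * r ^+ n by rewrite mulr_ge0// exprn_ge0.
apply: opbW (opbD (FC _ _ _ PL (PT n) w0 (hL n)) (opbBC (hL n.+1))).
  rewrite exprS; apply: le_trans (ltW hn).
  set w := r ^+ n in w0 hn *; set c := K / _ in C0 w0 hn *.
  nra.
Qed.

End BoundedOperators.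

(** * Inverses and square roots of operators [D >= 1] *)

Section Coercive.
Context {R : realType} {H : hilbertType R}.
Variable D : bop H.
Hypotheses (D_sa : adj D = D) (D_ge1 : forall x, nr x ^+ 2 <= dot (D x) x).

(** For small [e], |x - e D x|^2 <= (1 - 2e)|x|^2 + e^2 |D x|^2, which is below |x|^2 by a fixed
    factor. *)
Let D_shrink : exists e r : R,
  [/\ 0 < e, 0 <= r < 1 & opb r (1 - e%:C *: D)].
Proof.
have [k k0 Dk] := opb_exists D.
(* This makes e^2 |D x|^2 <= e |x|^2, leaving the factor 1 - e <= (1 - e/2)^2. *)
pose e : R := (k + 1) ^- 2.
have k1 : 1 <= (k + 1) ^+ 2 by nra.
have e0 : 0 < e by rewrite invr_gt0; lra.
have ek : e * (k + 1) ^+ 2 = 1 by rewrite mulVf//; lra.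
have e1 : e <= 1 by nra.
exists e, (1 - e / 2); split=> //; first by lra.
move=> x; rewrite -(@ler_pXn2r _ 2)// ?nnegrE ?nr_ge0//; last first.
  by rewrite mulr_ge0 ?nr_ge0//; lra.
rewrite bop_subE nrD_sqr nrN dotNr bop_scaleE dotZr nrZ bop_1E (gtr0_norm e0).
have : nr (D x) ^+ 2 <= (k + 1) ^+ 2 * nr x ^+ 2.
  rewrite -exprMn lerXn2r ?nnegrE ?nr_ge0 ?mulr_ge0 ?nr_ge0//; first lra.
  by rewrite (le_trans (Dk x))// ler_wpM2r ?nr_ge0//; lra.
move=> /(ler_wpM2l (ltW (mulr_gt0 e0 e0))).
have -> : e * e * ((k + 1) ^+ 2 * nr x ^+ 2) = e * (e * (k + 1) ^+ 2) * nr x ^+ 2.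
  by ring.
rewrite ek; have := ler_wpM2l (ltW e0) (D_ge1 x); rewrite (dotC x).
have := sqr_ge0 (e * nr x); lra.
Qed.

(** A Neumann series: the fixed point of T = 1 + A T with A = 1 - e D satisfies e D T = 1. The
    adjoint of this right inverse is a left inverse, so the two agree. *)
Lemma coercive_inv : exists X : bop H, [/\ D * X = 1, X * D = 1 & adj X = X].
Proof.
have [e [r [e0 /[dup] rb /andP[r0 _] Dr]]] := D_shrink.
set A := 1 - _ in Dr.
have [//|//|S T k _ _ k0 ST|L _ LE] :=
  @bop_fixpoint R H (fun T => 1 + A * T) (fun=> True) r rb I.
  by rewrite opprD addrACA subrr add0r -mulrBr; exact: opbM.
exists (e%:C *: L).
have DX : D * (e%:C *: L) = 1.
  move: LE; rewrite /A mulrBl mul1r addrCA => /eqP.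
  rewrite -subr_eq0 addrAC subrr add0r subr_eq0 bop_scaleAl => /eqP eL.
  by rewrite bop_scaleAr -eL.
have XD : adj (e%:C *: L) * D = 1 by rewrite -{1}D_sa -adjM DX adj_bop1.
have aX : adj (e%:C *: L) = e%:C *: L.
  by rewrite -[LHS]mulr1 -DX mulrA XD mul1r.
by split; rewrite // -aX.
Qed.

(** With A = 1 - e D, a fixed point of Y = (A + Y^2)/2 satisfies (1 - Y)^2 = 1 - A = e D, so (1 -
    Y)/sqrt e is a root of [D]. It is positive because the norm of Y is below 1. *)
Lemma coercive_sqrt : exists S : bop H, [/\ adj S = S,
  forall x, 0 <= dot (S x) x, S * S = D &
  forall U, D * U = U * D -> S * U = U * S].
Proof.
have [e [r [e0 /[dup] rb /andP[r0 r1] Dr]]] := D_shrink.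
set A := 1 - _ in Dr.
have A_sa : adj A = A by rewrite adjD adjN adj_bop1 adj_bopZ D_sa.
pose half : R[i] := (2^-1)%:C.
have halfD (T : bop H) : half *: T + half *: T = T.
  by rewrite -scalerDl -rmorphD /= -[RHS]scale1r; congr (_%:C *: _); field.
(* On the ball of radius [r] the map is [r]-Lipschitz; the last clause makes the root commute with
   everything that commutes with [D]. *)
pose P (Y : bop H) := [/\ opb r Y, adj Y = Y &
  forall U, A * U = U * A -> Y * U = U * Y].
have [||L PL|S T k [Sr _ _] [Tr _ _] k0 ST|Y [Yr Y_sa YU] YE] :=
  @bop_fixpoint R H (fun Y => half *: (A + Y * Y)) P r rb.
- by split; [exact: opb0 | rewrite adj_bop0 | move=> U _; rewrite mul0r mulr0].
- move=> Y [Yr Y_sa YU]; split.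
  + have -> : r = `|2^-1| * (r + r) by rewrite ger0_norm ?invr_ge0//; field.
    apply: opbZ; apply: opbD => //; apply: opbW (opbM r0 Yr Yr).
    by rewrite ler_piMl// ltW.
  + by rewrite adj_bopZ adjD adjM Y_sa A_sa.
  + move=> U AU; rewrite bop_scaleAl bop_scaleAr mulrDl mulrDr AU.
    by rewrite -mulrA (YU U)// (mulrA Y) (YU U)// mulrA.
(* Closedness of [P]: each clause is checked by comparing the limit [L] with a nearby [T] in the
   class. *)
- split.
  + move=> x; apply/ler_addgt0Pr => d d0.
    have d1 : 0 < d / (nr x + 1) by rewrite divr_gt0// ltr_wpDl ?nr_ge0.
    have [T [Tr _ _] LT] := PL _ d1.
    rewrite -[L](subrK T) addrC bop_addE (le_trans (nrD _ _))// lerD//.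
    rewrite (le_trans (LT x))// mulrAC ler_pdivrMr ?ltr_wpDl ?nr_ge0//.
    by rewrite ler_wpM2l ?ltW//; lra.
  + apply/eqP; rewrite -subr_eq0; apply/eqP/opb_eq0 => d d0.
    have d1 : 0 < d / 2 by lra.
    have [T [_ T_sa _] LT] := PL _ d1.
    rewrite -(subrKA T) -[X in _ - X + _]T_sa -adjN -adjD.
    have -> : d = d / 2 + d / 2 by field.
    by apply: opbD; [apply: opb_adj => //; exact: ltW | exact: opbBC].
  + move=> U AU; apply/eqP; rewrite -subr_eq0; apply/eqP/opb_eq0 => d d0.
    have [u u0 Uu] := opb_exists U.
    have d1 : 0 < d / (2 * u + 1) by rewrite divr_gt0//; lra.
    have [T [_ _ TU] LT] := PL _ d1.
    have -> : L * U - U * L = (L - T) * U + U * (T - L).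
      by rewrite mulrBl mulrBr TU// addrA subrK.
    apply: opbW (opbD (opbM (ltW d1) LT Uu) (opbM u0 Uu (opbBC LT))).
    rewrite (_ : _ + _ = d / (2 * u + 1) * (2 * u)); last by ring.
    by rewrite mulrAC ler_pdivrMr; [nra | lra].
- rewrite /= -scalerBr opprD addrACA subrr add0r.
  have -> : r * k = `|2^-1| * (r * k + k * r).
    by rewrite ger0_norm ?invr_ge0//; field.
  (* S^2 - T^2 = S (S - T) + (S - T) T, each term bounded by [r * k]. *)
  apply: opbZ; rewrite -[S * S](subrK (S * T)) -mulrBr -addrA -mulrBl.
  by apply: opbD; exact: opbM.
have s0 : 0 < Num.sqrt e by rewrite sqrtr_gt0.
exists ((Num.sqrt e)^-1%:C *: (1 - Y)); split.
- by rewrite adj_bopZ adjD adjN adj_bop1 Y_sa.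
- move=> x; rewrite bop_scaleE dotZl mulr_ge0 ?invr_ge0 ?sqrtr_ge0//.
  rewrite bop_subE dotDl dotNl dotxx.
  have := dot_le (Y x) x; have := ler_wpM2r (nr_ge0 x) (Yr x).
  have := ler_wpM2r (sqr_ge0 (nr x)) (ltW r1); lra.
- rewrite bop_scaleAl bop_scaleAr scalerA -rmorphM /= -invfM -expr2.
  rewrite sqr_sqrtr ?ltW// mulrBl mul1r mulrBr mulr1.
  have -> : Y * Y = Y + Y - A.
    by rewrite -{3 4}YE halfD addrC addKr.
  rewrite -addrA -opprD addrA !subKr scalerA -rmorphM /=.
  by rewrite mulVf ?scale1r// gt_eqF.
- move=> U DU; rewrite bop_scaleAl bop_scaleAr; congr (_ *: _).
  rewrite mulrBl mulrBr mul1r mulr1 YU// /A mulrBl mulrBr mul1r mulr1.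
  by rewrite bop_scaleAl bop_scaleAr DU.
Qed.

End Coercive.

(** * The matched projection *)

Section AdjointAlgebra.
Context {R : realType} {H : hilbertType R}.
Implicit Types (B S T U X Y Z : bop H) (x y : H).

Lemma adjM_eq0 T Z : adj T * T * Z = 0 -> T * Z = 0.
Proof.
move=> h; apply: bopP => x; rewrite bop_mulE; apply: nr_adj_eq0.
by rewrite -bop_mulE h.
Qed.

Lemma op_invP T X : T * X = 1 -> X * T = 1 -> op_inv T = X.
Proof.
move=> TX XT; rewrite /op_inv; case: xgetP => [Y _ [TY _]|/(_ X)[]//].
by rewrite -[Y]mul1r -XT -mulrA TY mulr1.
Qed.

(** Penrose's uniqueness argument: (TX)(TY) = TY, and taking adjoints of this product of
    self-adjoint factors gives TX = TY; likewise on the other side. *)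
Lemma MP_invP T X : is_MP_inverse T X -> MP_inv T = X.
Proof.
move=> [TXT XTX aTX aXT]; rewrite /MP_inv; case: xgetP => [Y _|/(_ X)[]//].
move=> [TYT YTY aTY aYT].
have TYX : T * Y = T * X.
  by rewrite -aTX -{2}TYT -(mulrA (T * Y)) adjM aTX aTY mulrA TXT.
have YTX : Y * T = X * T.
  by rewrite -aXT -{2}TYT -mulrA mulrA adjM aXT aYT -mulrA (mulrA T) TXT.
by rewrite -YTY YTX -mulrA TYX mulrA.
Qed.

End AdjointAlgebra.

(** * The weight [D] attached to an idempotent *)

Section Weight.
Context {R : realType} {H : hilbertType R}.
Variable Q : bop H.
Hypothesis Q_idem : is_idempotent Q.

Let P := adj Q.
Let P_idem : P * P = P. Proof. by rewrite -adjM Q_idem. Qed.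
Let W := Q + P - 1.
Let D := W * W.

Let QW : Q * W = Q * P.
Proof. by rewrite mulrBr mulrDr Q_idem mulr1 addrC addKr. Qed.

Let WQ : W * Q = P * Q.
Proof. by rewrite mulrBl mulrDl Q_idem mul1r addrC addKr. Qed.

Let PW : P * W = P * Q.
Proof. by rewrite mulrBr mulrDr P_idem mulr1 addrK. Qed.

Let WP : W * P = Q * P.
Proof. by rewrite mulrBl mulrDl P_idem mul1r addrK. Qed.

Let T := Q * P.

Let DQ : D * Q = T * Q. Proof. by rewrite -mulrA WQ mulrA WP. Qed.


Let W_sa : adj W = W.
Proof. by rewrite !adjD adjN adj_bop1 adjK (addrC P). Qed.

Let D_sa : adj D = D. Proof. by rewrite adjM W_sa. Qed.

Let DE : D = 1 + adj (Q - P) * (Q - P).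
Proof.
rewrite adjD adjN adjK -/P.
have -> : (P - Q) * (Q - P) = P * Q - P - (Q - Q * P).
  by rewrite mulrBl !mulrBr Q_idem P_idem.
have -> : D = Q * P + P * Q - W by rewrite /D {1}/W mulrBl mulrDl QW PW mul1r.
rewrite /W opprB addrCA opprB; congr (_ + _).
by rewrite addrACA -opprD (addrC (P * Q)) (addrC P).
Qed.

Let D_ge1 x : nr x ^+ 2 <= dot (D x) x.
Proof.
rewrite DE bop_addE dotDl dotxx bop_mulE adj_dot adjK.
by rewrite dotxx lerDl sqr_ge0.
Qed.

Lemma idempotent_weight : exists D : bop H, [/\ adj D = D,
  forall x, nr x ^+ 2 <= dot (D x) x & D * Q = Q * adj Q * Q].
Proof. by exists D. Qed.

End Weight.

(** * The absolute value of [adj Q] and the matched projection *)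

Section MatchedProjection.
Context {R : realType} {H : hilbertType R}.
Variables Q T D : bop H.
Hypotheses (Q_idem : is_idempotent Q) (TE : T = Q * adj Q).
Hypotheses (D_sa : adj D = D) (D_ge1 : forall x, nr x ^+ 2 <= dot (D x) x).
Hypothesis DQ : D * Q = T * Q.

Let T_sa : adj T = T. Proof. by rewrite TE adjM adjK. Qed.
Let DT : D * T = T * T. Proof. by rewrite {1 3}TE !mulrA DQ. Qed.
Let TD : T * D = T * T.
Proof. by rewrite -[LHS]adjK adjM D_sa T_sa DT adjM T_sa. Qed.

(** The root is E S, where S is the root of [D] and E = T D^-1 is the orthogonal projection onto the
    range of [Q]; these commute and E D = T. *)
Lemma idempotent_abs_exists : exists B, is_positive B /\ B * B = T.
Proof.
have [X [DX XD X_sa]] := coercive_inv D_sa D_ge1.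
have [S [S_sa S_ge0 SS SU]] := coercive_sqrt D_sa D_ge1.
have XT : X * T = T * X.
  by rewrite -[LHS]mulr1 -DX mulrA -(mulrA X) TD -DT mulrA XD mul1r.
have ST : S * T = T * S by rewrite SU// DT TD.
have SX : S * X = X * S by rewrite SU// DX XD.
have [E EE_def] : exists E, E = T * X by exists (T * X).
have EE : E * E = E.
  by rewrite EE_def mulrA -(mulrA T) XT mulrA -TD -(mulrA T D) DX mulr1.
have E_sa : adj E = E by rewrite EE_def adjM X_sa T_sa XT.
have SE : S * E = E * S by rewrite EE_def mulrA ST -mulrA SX mulrA.
have ESE : E * S = E * (S * E) by rewrite SE mulrA EE.
exists (E * S); split.
  apply: is_positive_dot => [|x]; first by rewrite adjM S_sa E_sa SE.
  by rewrite ESE !bop_mulE adj_dot E_sa.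
by rewrite mulrA -(mulrA E S) SE mulrA EE -mulrA SS EE_def -mulrA XD mulr1.
Qed.

(** [B] is an arbitrary positive root of [T], so what follows applies to the one that [op_sqrt]
    chooses. *)
Variable B : bop H.
Hypotheses (B_ge0 : is_positive B) (BB : B * B = T).

Let B_sa : adj B = B := is_positive_sa B_ge0.

(** [adj B * B] is [Q * adj Q], which annihilates [1 - adj Q]. *)
Let BZ : B * (1 - adj Q) = 0.
Proof.
apply: adjM_eq0; rewrite B_sa BB TE -mulrA mulrBr mulr1 -adjM Q_idem subrr.
by rewrite mulr0.
Qed.

Let BP : B * adj Q = B.
Proof.
by apply/eqP; rewrite eq_sym -subr_eq0 -{1}[B]mulr1 -mulrBr BZ.
Qed.

Let QB : Q * B = B.
Proof. by rewrite -[LHS]adjK adjM B_sa BP. Qed.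

Let DB : D * B = T * B. Proof. by rewrite -{1}QB mulrA DQ -mulrA QB. Qed.
Let TB : T * B = B * T. Proof. by rewrite -BB mulrA. Qed.
Let BD : B * D = T * B.
Proof. by rewrite -[LHS]adjK adjM D_sa B_sa DB adjM B_sa T_sa TB. Qed.

Let MP_inv_abs : exists Y, [/\ MP_inv B = Y, adj Y = Y, B * Y = Y * B,
  B * Y * B = B & Y * B * Y = Y].
Proof.
have [X [DX XD X_sa]] := coercive_inv D_sa D_ge1.
have BX : B * X = X * B.
  by rewrite -[RHS]mulr1 -DX mulrA -(mulrA X) BD -DB mulrA XD mul1r.
have [Y YE] : exists Y, Y = B * X by exists (B * X).
have Y_sa : adj Y = Y by rewrite YE adjM B_sa X_sa BX.
have BY : B * Y = Y * B by rewrite YE -mulrA -BX.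
have BYB : B * Y * B = B.
  by rewrite YE mulrA BB -mulrA -BX mulrA -BD -mulrA DX mulr1.
have YBY : Y * B * Y = Y by rewrite -BY {2}YE mulrA BYB YE.
exists Y; split=> //; apply: MP_invP; split=> //.
  by rewrite adjM B_sa Y_sa BY.
by rewrite adjM B_sa Y_sa BY.
Qed.

Let op_inv_abs : exists V, [/\ op_inv (B + 1) = V, adj V = V,
  (B + 1) * V = 1, V * (B + 1) = 1 & B * V = V * B].
Proof.
have B1_sa : adj (B + 1) = B + 1 by rewrite adjD B_sa adj_bop1.
have [|V [V1 V2 V_sa]] := coercive_inv B1_sa.
  move=> x; rewrite bop_addE bop_1E dotDl dotxx lerDr.
  by have := B_ge0 x; rewrite lecE => /andP[].
exists V; split=> //; first exact: op_invP.
by apply: (addIr V); move: V1 V2; rewrite mulrDl mul1r mulrDr mulr1 => -> ->.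
Qed.

(** The formula of [matched_projection], with [B] in place of [op_abs (adj Q)]. *)
Let M := 2^-1 *: ((B + adj Q) * MP_inv B * op_inv (B + 1) * (B + Q)).

Let K := B * (B + 1).

Let cross : (B + Q) * (B + adj Q) = 2%:R *: K.
Proof.
rewrite /K mulrDl !mulrDr BB BP QB -TE mulr1 (addrC B T).
by rewrite scaler_nat mulr2n.
Qed.

Let M_factor : exists G, [/\ M = 2^-1 *: ((B + adj Q) * G * (B + Q)),
  adj G = G, G * K * G = G & K * G * K = K].
Proof.
have [Y [YE Y_sa BY BYB YBY]] := MP_inv_abs.
have [V [VE V_sa B1V VB1 BV]] := op_inv_abs.
have VY : V * Y = Y * V.
  rewrite -[LHS]mulr1 -B1V mulrA -(mulrA V) (_ : Y * _ = (B + 1) * Y).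
    by rewrite mulrA VB1 mul1r.
  by rewrite mulrDl mulrDr BY mul1r mulr1.
have KG : K * (Y * V) = B * Y.
  by rewrite -VY mulrA /K -(mulrA B) B1V mulr1.
have GK : Y * V * K = Y * B.
  by rewrite /K mulrA -(mulrA Y) -BV mulrA -mulrA VB1 mulr1.
exists (Y * V); split.
- by rewrite /M YE VE -!mulrA.
- by rewrite adjM Y_sa V_sa VY.
- by rewrite GK mulrA YBY.
- by rewrite KG /K mulrA BYB.
Qed.

Lemma matched_is_projection : is_projection M.
Proof.
have [G [-> G_sa GKG _]] := M_factor.
have E2 : (2^-1 : R[i]) = (2^-1)%:C by rewrite fmorphV rmorph_nat.
split; last first.
  by rewrite /is_self_adjoint E2 adj_bopZ !adjM !adjD adjK B_sa G_sa mulrA.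
rewrite /is_idempotent bop_scaleAl bop_scaleAr; congr (_ *: _).
rewrite !mulrA -(mulrA _ (B + Q)) cross bop_scaleAr !bop_scaleAl scalerA.
rewrite mulVf ?pnatr_eq0// scale1r -(mulrA (B + adj Q)) -(mulrA (B + adj Q)).
by rewrite GKG.
Qed.

(** Since L M L^* = 2 K with L = B + Q, M = 0 forces K = 0, hence B = 0 and Q Q^* = 0. *)
Lemma matched_neq0 : Q <> 0 -> M <> 0.
Proof.
move=> Q0 M0; apply: Q0.
have [G [ME _ _ KGK]] := M_factor.
have [V [_ _ B1V _ _]] := op_inv_abs.
have : (B + Q) * M * (B + adj Q) = 2%:R *: K.
  rewrite ME bop_scaleAr bop_scaleAl !mulrA cross -(mulrA _ (B + Q)) cross.
  by rewrite !(bop_scaleAl, bop_scaleAr) KGK !scalerA mulVf ?mul1r.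
rewrite M0 mulr0 mul0r => /esym/eqP; rewrite scaler_eq0 pnatr_eq0 /= => /eqP K0.
have B0 : B = 0 by rewrite -[B]mulr1 -B1V mulrA -/K K0 mul0r.
have : adj (adj Q) * adj Q * 1 = 0 by rewrite adjK mulr1 -TE -BB B0 mul0r.
move=> /adjM_eq0; rewrite mulr1 => /(congr1 (@adj R H)).
by rewrite adjK adj_bop0.
Qed.

(** If M = 1 then B + Q is injective. It annihilates Z - V Q Z for Z = 1 - Q^*, so Z = V Q Z has its
    range inside that of [Q]; as Q^* Z = 0, this forces Z = 0. *)
Lemma matched_neq1 : Q <> 1 -> M <> 1.
Proof.
move=> Q1 M1; apply: Q1.
have [G [ME _ _ _]] := M_factor.
have [V [_ _ B1V VB1 _]] := op_inv_abs.
pose Z := 1 - adj Q.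
have B1VQ : B * (V * Q) + V * Q = Q.
  by rewrite -[X in _ + X]mul1r -mulrDl mulrA B1V mul1r.
(* [B1VQ] writes V Q as Q - B V Q, and both terms are fixed by left multiplication by [Q]. *)
have QVQ : Q * (V * Q) = V * Q.
  have <- : Q - B * (V * Q) = V * Q by rewrite -{1}B1VQ addrC addKr.
  by rewrite mulrBr Q_idem (mulrA Q B) QB.
have N0 : (B + Q) * (Z - V * Q * Z) = 0.
  by rewrite mulrBr mulrDl BZ add0r mulrA (mulrDl B Q) QVQ B1VQ subrr.
have ZE : Z = V * Q * Z.
  apply/eqP; rewrite -subr_eq0; apply/eqP.
  by rewrite -[LHS]mul1r -M1 ME bop_scaleAl -mulrA N0 mulr0 scaler0.
have QZ : Q * Z = Z by rewrite {1}ZE !mulrA -(mulrA Q V) QVQ -ZE.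
have Z0 : Z = 0.
  rewrite -QZ; apply: adjM_eq0; rewrite -mulrA QZ /Z mulrBr mulr1.
  by rewrite -adjM Q_idem subrr.
have Q1 : adj Q = 1 by apply/eqP; rewrite eq_sym -subr_eq0 -/Z Z0.
by rewrite -[Q]adjK Q1 adj_bop1.
Qed.

End MatchedProjection.

Lemma matched_projectionP {R : realType} {H : hilbertType R} (Q : bop H) :
  is_idempotent Q -> ~ is_self_adjoint Q ->
  [/\ is_projection (matched_projection Q), matched_projection Q <> 0 &
      matched_projection Q <> 1].
Proof.
move=> Q_idem Q_nsa; have [D [D_sa D_ge1 DQ]] := idempotent_weight Q_idem.
have [B0 B0P] := idempotent_abs_exists (erefl _) D_sa D_ge1 DQ.
(* Existence of the root [B0] rules out the default value 0 of [xget]. *)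
have [B_ge0 BB] : is_positive (op_abs (adj Q)) /\
    op_abs (adj Q) * op_abs (adj Q) = Q * adj Q.
  by rewrite /op_abs /op_sqrt adjK; case: xgetP => [B _ []//|/(_ B0)[]].
split.
- exact: (matched_is_projection Q_idem (erefl _) D_sa D_ge1 DQ B_ge0 BB).
- apply: (matched_neq0 Q_idem (erefl _) D_sa D_ge1 DQ B_ge0 BB) => Q0.
  by apply: Q_nsa; rewrite Q0 /is_self_adjoint adj_bop0.
- apply: (matched_neq1 Q_idem (erefl _) D_sa D_ge1 DQ B_ge0 BB) => Q1.
  by apply: Q_nsa; rewrite Q1 /is_self_adjoint adj_bop1.
Qed.

(** * Operator norm and rank-one operators *)

Section OperatorNorm.
Context {R : realType} {H : hilbertType R}.
Implicit Types (S T : bop H) (x : H) (k : R).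

Let unit_image T := [set complex.Re `|T x| | x in [set x : H | `|x| <= 1]].

Let unit_ballE x : (`|x| <= 1) = (nr x <= 1).
Proof. by rewrite normE -(lecR (nr x)). Qed.

Let opnorm_has_sup T : has_sup (unit_image T).
Proof.
split; first by exists (nr (T 0)), 0 => //=; rewrite normr0 ler01.
have [k k0 Tk] := opb_exists T; exists k => _ [x /= x1 <-].
rewrite unit_ballE in x1; rewrite -/(nr _) (le_trans (Tk x))//.
exact: ler_piMr.
Qed.

Lemma opnorm_ge0 T : 0 <= opnorm T.
Proof.
apply: (@le_trans _ _ (nr (T 0))); first exact: nr_ge0.
apply: sup_upper_bound; first exact: opnorm_has_sup.
by exists 0 => //=; rewrite normr0 ler01.
Qed.

Lemma opnorm_opb T : opb (opnorm T) T.
Proof.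
move=> x; have [->|x0] := eqVneq x 0.
  by rewrite linear0 nr0 mulr0.
have nx0 : 0 < nr x by rewrite nr_gt0.
rewrite -ler_pdivrMr// mulrC -[_^-1]gtr0_norm ?invr_gt0// -nrZ -linearZ.
apply: sup_upper_bound; first exact: opnorm_has_sup.
exists ((nr x)^-1%:C *: x) => //=.
by rewrite unit_ballE nrZ gtr0_norm ?invr_gt0// mulVf// gt_eqF.
Qed.

Lemma opnorm_le k T : 0 <= k -> opb k T -> opnorm T <= k.
Proof.
move=> k0 Tk; apply: ge_sup; first by case: (opnorm_has_sup T).
move=> _ [x /= x1 <-]; rewrite unit_ballE in x1.
by rewrite -/(nr _) (le_trans (Tk x))// ler_piMr.
Qed.

Lemma lt_opnorm k T : 0 <= k -> k < opnorm T -> exists x, k * nr x < nr (T x).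
Proof.
move=> k0; rewrite ltNge => /negP kT; apply: contrapT => /forallNP h.
by apply/kT/opnorm_le => // x; rewrite leNgt; apply/negP.
Qed.

Lemma opnorm_dist k S T : 0 <= k -> opb k (S - T) ->
  `|opnorm S - opnorm T| <= k.
Proof.
move=> k0.
suff aux S' T' : opb k (S' - T') -> opnorm S' - opnorm T' <= k.
  by move=> ST; rewrite ler_norml aux// andbT lerNl opprB aux//; exact: opbBC.
move=> ST; rewrite lerBlDr; apply: opnorm_le; first exact/addr_ge0/opnorm_ge0.
by rewrite -[S'](subrK T'); apply: opbD => //; exact: opnorm_opb.
Qed.

End OperatorNorm.

Section RankOne.
Context {R : realType} {H : hilbertType R}.
Implicit Types (u v w x y : H) (M N : bop H).

(** The factor 2 comes from bounding real and imaginary parts separately; it is harmless for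
    boundedness and continuity. *)
Let norm_inner_le x y : complex.Re `|inner x y| <= 2 * nr x * nr y.
Proof.
have : `|inner x y| <= (`|complex.Re (inner x y)| + `|complex.Im (inner x y)|)%:C.
  rewrite {1}[inner x y]complexE rmorphD /= (le_trans (ler_normD _ _))//.
  by rewrite normrM !normc_def /= !(expr0n, expr1n, addr0, add0r) sqrtr1
    mul1r !sqrtr_sqr.
rewrite lecE => /andP[_] /le_trans; apply => /=.
rewrite innerZi normrN -mulrA mulr2n mulrDl mul1r; apply: lerD.
  exact: dot_norm_le.
rewrite (le_trans (dot_norm_le _ _))// nrZc.
by rewrite normc_def /= expr0n expr1n add0r sqrtr1 mul1r.
Qed.

Fact rank_one_linear u v : linear (fun x => inner x v *: u).
Proof.
by move=> a x y; rewrite linearDl linearZl_LR scalerDl scalerA.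
Qed.

Let rank_one_nr u v x : nr (inner x v *: u) <= 2 * nr u * nr v * nr x.
Proof.
rewrite nrZc (le_trans (ler_wpM2r (nr_ge0 u) (norm_inner_le x v)))//.
by rewrite le_eqVlt; apply/orP; left; apply/eqP; ring.
Qed.

Fact rank_one_bounded u v :
  exists K : R[i], forall x, `|inner x v *: u| <= K * `|x|.
Proof.
exists (2 * nr u * nr v)%:C => x.
by rewrite !normE -rmorphM /= lecR rank_one_nr.
Qed.

Definition rank_one u v : bop H :=
  Bop (rank_one_linear u v) (rank_one_bounded u v).

Lemma rank_oneE u v x : rank_one u v x = inner x v *: u.
Proof. by []. Qed.

Lemma rank_one_opb u v : opb (2 * nr u * nr v) (rank_one u v).
Proof. exact: rank_one_nr. Qed.

Lemma rank_one_diag_opb u v : opb (2 * (nr u + nr v) * nr (u - v))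
  (rank_one u u - rank_one v v).
Proof.
have -> : rank_one u u - rank_one v v =
    rank_one u (u - v) + rank_one (u - v) v.
  apply: bopP => x; rewrite bop_subE bop_addE !rank_oneE linearBr scalerBl.
  by rewrite scalerBr addrA subrK.
rewrite (_ : _ * _ * _ = 2 * nr u * nr (u - v) + 2 * nr (u - v) * nr v).
  by apply: opbD; exact: rank_one_opb.
by ring.
Qed.

Let adj_rank_one v : adj (rank_one v v) = rank_one v v.
Proof.
apply: adj_uniq => x y; rewrite /dot !rank_oneE linearZl_LR linearZr_LR /=.
by rewrite (innerC v y) mulrC.
Qed.

Let rank_one_idem v : nr v = 1 -> rank_one v v * rank_one v v = rank_one v v.
Proof.
move=> v1; apply: bopP => x; rewrite bop_mulE !rank_oneE linearZl_LR /=.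
have -> : inner v v = 1 by rewrite innerE normE v1 expr1n.
by rewrite mulr1.
Qed.

Lemma projection_sub_line M u : is_projection M -> M u = u -> nr u = 1 ->
  is_projection (M - rank_one u u).
Proof.
move=> [M_idem M_sa] Mu u1.
have MO : M * rank_one u u = rank_one u u.
  by apply: bopP => x; rewrite bop_mulE rank_oneE linearZ /= Mu.
have OM : rank_one u u * M = rank_one u u.
  by rewrite -[LHS]adjK adjM adj_rank_one M_sa MO adj_rank_one.
split; last by rewrite /is_self_adjoint adjD adjN M_sa adj_rank_one.
by rewrite /is_idempotent mulrBl !mulrBr M_idem MO OM rank_one_idem//
  subrr subr0.
Qed.

Lemma projection_add_line N v : is_projection N -> N v = 0 -> nr v = 1 ->
  is_projection (N + rank_one v v).
Proof.
move=> [N_idem N_sa] Nv v1.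
have NO : N * rank_one v v = 0.
  by apply: bopP => x; rewrite bop_mulE rank_oneE linearZ /= Nv scaler0.
have ON : rank_one v v * N = 0.
  by rewrite -[LHS]adjK adjM adj_rank_one N_sa NO adj_bop0.
split; last by rewrite /is_self_adjoint adjD N_sa adj_rank_one.
by rewrite /is_idempotent mulrDl !mulrDr N_idem NO ON rank_one_idem//
  addr0 add0r.
Qed.

End RankOne.

(** * Rotating a projection *)

Section Path.
Context {R : realType} {H : hilbertType R}.
Implicit Types (x e u v w : H) (M Q T : bop H) (a : R).

Let lt_nr_perturb T a x e : 0 <= a -> a * nr x < nr (T x) ->
  exists2 d : R, 0 < d & a * nr (x + d%:C *: e) < nr (T (x + d%:C *: e)).
Proof.
move=> a0 ax; have [k k0 Tk] := opb_exists T.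
set c := (k + a) * nr e + 1.
have c0 : 0 < c by rewrite ltr_wpDl// mulr_ge0 ?nr_ge0// addr_ge0.
(* Moving [x] by [d] times [e] changes the gap by at most d (k + a) |e|, less than half of it; the
   summand 1 in [c] guards against division by zero. *)
pose d := (nr (T x) - a * nr x) / (2 * c).
have d0 : 0 < d by rewrite divr_gt0 ?subr_gt0// mulr_gt0.
have dc : d * c = (nr (T x) - a * nr x) / 2.
  by rewrite /d; field; rewrite gt_eqF.
exists d => //.
have h1 : nr (x + d%:C *: e) <= nr x + d * nr e.
  by rewrite (le_trans (nrD _ _))// nrZ gtr0_norm.
have h2 : nr (T x) <= nr (T (x + d%:C *: e)) + d * (k * nr e).
  rewrite -{1}[x](addrK (d%:C *: e)) linearB (le_trans (nrD _ _))// nrN.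
  rewrite lerD2l linearZ nrZ gtr0_norm// ler_wpM2l//; first exact: ltW.
  exact: Tk.
have := ler_wpM2l a0 h1.
rewrite /c in dc; move: dc h2 ax d0; lra.
Qed.

Let generic_vector T M a : is_idempotent M -> M <> 0 -> M <> 1 ->
  0 <= a -> a < opnorm T ->
  exists x, [/\ a * nr x < nr (T x), M x <> 0 & x - M x <> 0].
Proof.
move=> M_idem M0 M1 a0 /(lt_opnorm a0)[x ax].
have MM y : M (M y) = M y by rewrite -bop_mulE M_idem.
have [Mx|Mx] := pselect (M x = 0).
  have [y My] : exists y, M y <> 0.
    by apply: contrapT => /forallNP h; apply/M0/bopP => y; apply: contrapT.
  have [d d0 ad] := lt_nr_perturb (M y) a0 ax.
  exists (x + d%:C *: M y); split=> //; rewrite linearD linearZ /= MM Mx add0r.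
    move/eqP; rewrite scaler_eq0 => /orP[|/eqP//].
    by rewrite eq_complex /= (gt_eqF d0).
  (* The complementary component is [x] itself, nonzero because the strict inequality [ax] fails at
     0. *)
  rewrite addrK => x0; move: ax.
  by rewrite x0 linear0 nr0 mulr0 ltxx.
have [Nx|Nx] := pselect (x - M x = 0); last by exists x.
have [y My] : exists y, y - M y <> 0.
  apply: contrapT => /forallNP h; apply/M1/bopP => y; apply/esym/eqP.
  by rewrite bop_1E -subr_eq0; apply/eqP; exact: contrapT (h y).
have [d d0 ad] := lt_nr_perturb (y - M y) a0 ax.
exists (x + d%:C *: (y - M y)).
have MN : M (y - M y) = 0 by rewrite linearB /= MM subrr.
have Mx' : M (x + d%:C *: (y - M y)) = M x.
  by rewrite (linearD M) linearZ /= MN scaler0 addr0.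
split; rewrite // Mx'// addrAC Nx add0r; move/eqP.
rewrite scaler_eq0 => /orP[|/eqP//].
by rewrite eq_complex /= (gt_eqF d0).
Qed.

Let unitP x : x != 0 -> exists y, [/\ y = (nr x)^-1%:C *: x,
  x = (nr x)%:C *: y & nr y = 1].
Proof.
move=> x0; exists ((nr x)^-1%:C *: x); split=> //.
  by rewrite scalerA -rmorphM /= mulfV ?scale1r// nr_eq0.
by rewrite nrZ gtr0_norm ?invr_gt0 ?nr_gt0// mulVf// nr_eq0.
Qed.

Lemma projection_attains M Q a : is_projection M -> M <> 0 -> M <> 1 ->
  opnorm (M - Q) <= a -> a <= opnorm (1 - M - Q) ->
  exists P, is_projection P /\ opnorm (P - Q) = a.
Proof.
move=> M_proj M0 M1 Ma; have [M_idem M_sa] := M_proj.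
rewrite le_eqVlt => /predU1P[->|aT].
  exists (1 - M); split=> //; split.
    by rewrite /is_idempotent mulrBl !mulrBr !mul1r mulr1 M_idem subrr subr0.
  by rewrite /is_self_adjoint adjD adjN adj_bop1 M_sa.
have a0 : 0 <= a by rewrite (le_trans (opnorm_ge0 _) Ma).
have [x [ax /eqP Mx /eqP Nx]] := generic_vector M_idem M0 M1 a0 aT.
set u0 := M x in Mx Nx; set w0 := x - u0 in Nx.
have Mu0 : M u0 = u0 by rewrite -bop_mulE M_idem.
have Mw0 : M w0 = 0 by rewrite linearB /= Mu0 subrr.
have [u [uE u0E u1]] := unitP Mx.
have [w [wE w0E w1]] := unitP Nx.
have Mu : M u = u by rewrite uE linearZ /= Mu0.
have Mw : M w = 0 by rewrite wE linearZ /= Mw0 scaler0.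
have uw : inner u w = 0 by rewrite -Mu adjP M_sa Mw linear0r.
have wu : inner w u = 0 by rewrite -Mu -{1}M_sa -adjP Mw linear0l.
(* A unit vector rotating from [u] at 0 to [w] at pi/2. *)
pose v t := (cos t)%:C *: u + (sin t)%:C *: w.
have v1 t : nr (v t) = 1.
  apply/eqP; rewrite -(@eqrXn2 _ 2)// ?nr_ge0//; apply/eqP.
  rewrite nrD_sqr !nrZ u1 w1 !mulr1 !real_normK ?num_real// dotZl dotZr.
  by rewrite (_ : dot u w = 0) ?/dot ?uw// !mulr0 addr0 cos2Dsin2 expr1n.
have uu : inner u u = 1 by rewrite innerE normE u1 expr1n.
(* Removing the line of [u] from the range of [M] leaves a projection that kills both [u] and [w],
   so every line of [v t] can be added to it. *)
pose N := M - rank_one u u.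
have Nv t : N (v t) = 0.
  have Mv : M (v t) = (cos t)%:C *: u.
    by rewrite (linearD M) !linearZ /= Mu Mw scaler0 addr0.
  rewrite bop_subE rank_oneE Mv /v linearDl !linearZl_LR /= uu wu.
  by rewrite mulr1 mulr0 addr0 subrr.
have N_proj : is_projection N by exact: projection_sub_line.
pose P t := N + rank_one (v t) (v t).
have P_proj t : is_projection (P t) by exact: projection_add_line.
pose f t := opnorm (P t - Q).
have f0 : f 0 <= a.
  by rewrite /f /P /N /v cos0 sin0 scale1r scale0r addr0 subrK.
have fpi : a <= f (pi / 2).
  rewrite leNgt; apply/negP => fa; move: ax; apply/negP; rewrite -leNgt.
  (* At pi/2 the path sends [x] to its [w] component, which is also (1 - M) x. *)
  rewrite (_ : _ x = (P (pi / 2) - Q) x).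
    by rewrite (le_trans (opnorm_opb _ _))// ler_wpM2r ?nr_ge0// ltW.
  have xE : x = (nr u0)%:C *: u + (nr w0)%:C *: w.
    by rewrite -u0E -w0E /w0 subrKC.
  rewrite !bop_subE bop_1E; congr (_ - _).
  rewrite /P /N /v cos_pihalf sin_pihalf scale0r scale1r add0r.
  rewrite bop_addE bop_subE !rank_oneE -/u0 -/w0 xE.
  rewrite !linearDl !linearZl_LR /= uu uw wu !mulr0 mulr1 add0r addr0 -u0E.
  by rewrite subrr add0r innerE normE w1 expr1n mulr1 -w0E.
have fcont : continuous f.
  move=> t; apply/cvgrPdist_le => e e0.
  (* For unit vectors [rank_one_diag_opb] has the factor 2 (1 + 1) = 4, and cosine and sine each
     contribute one increment. *)
  have e8 : 0 < e / 8 by lra.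
  have /cvgrPdist_le/(_ _ e8) ct := @continuous_cos R t.
  have /cvgrPdist_le/(_ _ e8) st := @continuous_sin R t.
  near=> s; apply: opnorm_dist; first exact: ltW.
  have -> : P t - Q - (P s - Q) =
      rank_one (v t) (v t) - rank_one (v s) (v s).
    by rewrite opprB addrA subrK /P opprD addrACA subrr add0r.
  apply: opbW (rank_one_diag_opb (v t) (v s)); rewrite !v1.
  have h : nr (v t - v s) <= `|cos t - cos s| + `|sin t - sin s|.
    rewrite /v opprD addrACA -!scalerBl -!rmorphB /= (le_trans (nrD _ _))//.
    by rewrite !nrZ u1 w1 !mulr1.
  have c8 : `|cos t - cos s| <= e / 8 by near: s.
  have s8 : `|sin t - sin s| <= e / 8 by near: s.
  lra.
have pi0 : (0 : R) <= pi / 2 by rewrite divr_ge0// pi_ge0.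
have [|t _ ft] := @IVT R f 0 (pi / 2) a pi0 (continuous_subspaceT fcont).
  by rewrite ge_min f0 le_max fpi orbT.
by exists (P t).
Unshelve. all: by end_near.
Qed.

End Path.

Theorem theorem2p9 (R : realType) (H : hilbertType R)
  (H_neq0 : exists x : H, x != 0)
  (Q : bop H) (Q_idem : is_idempotent Q) (Q_nonproj : ~ is_self_adjoint Q)
  (alpha : R)
  (alpha_ge : opnorm (matched_projection Q - Q) <= alpha)
  (alpha_le : alpha <= opnorm (1 - matched_projection Q - Q)) :
  exists P : bop H, is_projection P /\ opnorm (P - Q) = alpha.
Proof.
have [M_proj M0 M1] := matched_projectionP Q_idem Q_nonproj.
exact: projection_attains M_proj M0 M1 alpha_ge alpha_le.
Qed.
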